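(* Let $w=(w(n))_{n\in\mathbb{N}}$ be a bounded, strictly positive sequence such that $\mathsf{C}^{(1,w)}\in\mathcal{L}(\ell_1(w))$. (i) $\mathsf{C}^{(1,w)}$ is power bounded if and only if the sequence $\{(\mathsf{C}^{(1,w)})^m\}_{m\in\mathbb{N}}$ converges in the strong operator topology of $\mathcal{L}(\ell_1(w))$ to the projection onto $\mathrm{Ker}(I-\mathsf{C}^{(1,w)})$ along $\overline{(I-\mathsf{C}^{(1,w)})(\ell_1(w))}$. In this case, $\mathsf{C}^{(1,w)}$ is necessarily mean ergodic. (ii) $\mathsf{C}^{(1,w)}$ is mean ergodic if and only if $\mathsf{C}^{(1,w)}$ is Cesàro bounded.
   Context: The discrete Cesàro operator $\mathsf{C}\colon\mathbb{C}^{\mathbb{N}}\to\mathbb{C}^{\mathbb{N}}$ is the linear map $\mathsf{C}x:=\left(\frac{x_1+\dots+x_n}{n}\right)_{n\in\mathbb{N}}$ for $x=(x_n)_{n\in\mathbb{N}}$, with $\mathbb{N}=\{1,2,\dots\}$. For a bounded, strictly positive sequence $w$, $\ell_1(w):=\{x\in\mathbb{C}^{\mathbb{N}}\colon \sum_{n=1}^\infty w(n)|x_n|<\infty\}$, a Banach space for the norm $\|x\|_{1,w}:=\sum_{n=1}^\infty w(n)|x_n|$. $\mathcal{L}(X)$ is the space of continuous linear operators on a Banach space $X$; $I$ is the identity. Writing $\mathsf{C}^{(1,w)}\in\mathcal{L}(\ell_1(w))$ means that $\mathsf{C}$ maps $\ell_1(w)$ continuously into itself, and $\mathsf{C}^{(1,w)}$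 denotes the restriction of $\mathsf{C}$ to $\ell_1(w)$. For $T\in\mathcal{L}(X)$ let $T_{[n]}:=\frac1n\sum_{m=1}^nT^m$, $n\in\mathbb{N}$. $T$ is power bounded if $\sup_n\|T^n\|<\infty$; Cesàro bounded if $\sup_n\|T_{[n]}\|<\infty$; mean ergodic if there is $P\in\mathcal{L}(X)$ with $\lim_{n\to\infty}T_{[n]}x=Px$ for each $x\in X$. Convergence to ''the projection onto $Y$ along $Z$'' includes that $X=Y\oplus Z$. *)

(* Defs.v *)
From HB Require Import structures.
From mathcomp Require Import all_boot all_order all_algebra.
From mathcomp Require Import all_classical all_reals all_analysis.
From mathcomp Require Import complex.

Set Implicit Arguments.
Unset Strict Implicit.
Unset Printing Implicit Defensive.

Import Order.TTheory GRing.Theory Num.Theory.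
Import numFieldNormedType.Exports.
Import ComplexField.Normc.

Local Open Scope classical_set_scope.
Local Open Scope complex_scope.
Local Open Scope ring_scope.

(* Sequences are indexed from 0: [x n] and [w n] stand for the terms usually
   written x_(n+1) and w(n+1). *)

Section WeightedEll1.
Variable R : realType.
Implicit Types (w : nat -> R) (x y : nat -> R[i]).

Definition ell1_norm w x : \bar R :=
  (\sum_(0 <= n <oo) (w n * normc (x n))%:E)%E.

Definition in_ell1 w : {pred (nat -> R[i])} := fun x => (ell1_norm w x < +oo)%E.

Definition cesaro_op x : nat -> R[i] :=
  fun n => (\sum_(0 <= k < n.+1) x k) / n.+1%:R.

(* The positivity proof is a parameter of the type because the norm is definite
   only for strictly positive weights. *)
Record ell1 w (w_gt0 : forall n, 0 < w n) :=
  Ell1 { ell1_seq :> nat -> R[i] ; ell1_seqP : ell1_seq \in in_ell1 w }.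

Section Structure.
Variables (w : nat -> R) (w_gt0 : forall n, 0 < w n).

Lemma normc_ge0 (z : R[i]) : 0 <= normc z.
Proof. by case: z => a b; exact: sqrtr_ge0. Qed.

Lemma normc_normr (z : R[i]) : (normc z)%:C = `|z|.
Proof. by []. Qed.

Let term_ge0 x n : (0 <= (w n * normc (x n))%:E)%E.
Proof. by rewrite lee_fin mulr_ge0 ?normc_ge0// ltW. Qed.

Lemma ell1_norm_ge0 x : (0 <= ell1_norm w x)%E.
Proof. by apply: nneseries_ge0 => n _ _; exact: term_ge0. Qed.

Lemma ell1_normD x y : (ell1_norm w (x + y)%R <= ell1_norm w x + ell1_norm w y)%E.
Proof.
rewrite /ell1_norm -nneseriesD; do ?[by move=> *; exact: term_ge0].
apply: lee_nneseries => [n _ _|n _]; first exact: (term_ge0 (x + y) n).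
by rewrite -EFinD lee_fin -mulrDr ler_wpM2l ?le_normcD// ltW.
Qed.

Lemma ell1_normZ (a : R[i]) x :
  ell1_norm w (a *: x) = ((normc a)%:E * ell1_norm w x)%E.
Proof.
rewrite /ell1_norm -nneseriesZl; last by move=> *; exact: term_ge0.
by apply: eq_eseriesr => n _; rewrite -EFinM normcM mulrCA.
Qed.

Fact in_ell1_submod_closed : submod_closed (in_ell1 w).
Proof.
split=> [|a x y].
  rewrite unfold_in /in_ell1 /ell1_norm eseries0 ?ltry// => n _ _.
  by rewrite normc0 mulr0.
rewrite !unfold_in /in_ell1 => x1 y1.
apply: le_lt_trans (ell1_normD _ _) _; rewrite lte_add_pinfty// ell1_normZ.
by rewrite lte_mul_pinfty// lee_fin normc_ge0.
Qed.

HB.instance Definition _ :=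
  GRing.isSubmodClosed.Build R[i] (nat -> R[i]) (in_ell1 w) in_ell1_submod_closed.

HB.instance Definition _ := [isSub for @ell1_seq w w_gt0].
HB.instance Definition _ := [Choice of ell1 w_gt0 by <:].
HB.instance Definition _ :=
  [SubChoice_isSubLmodule of ell1 w_gt0 by <:].

Local Notation V := (ell1 w_gt0).

Definition ell1_mnorm (x : V) : R[i] := (fine (ell1_norm w x))%:C.

Lemma ell1_norm_fin_num (x : V) : ell1_norm w x \is a fin_num.
Proof. by rewrite ge0_fin_numE ?ell1_norm_ge0//; exact: (ell1_seqP x). Qed.

Fact ell1_mnormD (x y : V) : ell1_mnorm (x + y) <= ell1_mnorm x + ell1_mnorm y.
Proof.
rewrite /ell1_mnorm -rmorphD /= lecR -fineD ?ell1_norm_fin_num//.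
rewrite fine_le ?ell1_normD ?fin_numD ?ell1_norm_fin_num//.
exact: (ell1_norm_fin_num (x + y)).
Qed.

Fact ell1_mnormZ (a : R[i]) (x : V) : ell1_mnorm (a *: x) = `|a| * ell1_mnorm x.
Proof.
rewrite /ell1_mnorm (ell1_normZ a x) fineM ?ell1_norm_fin_num//.
by rewrite rmorphM /= normc_normr.
Qed.

Fact ell1_mnorm0_eq0 (x : V) : ell1_mnorm x = 0 -> x = 0.
Proof.
move=> /(@complexI _ _ 0) /eqP.
rewrite fine_eq0 ?ell1_norm_fin_num// => /eqP x0.
apply/val_inj/funext => n /=; apply: eq0_normc; apply/eqP.
have : ((w n * normc (x n))%:E <= ell1_norm w x)%E.
  apply: le_trans (nneseries_lim_ge n.+1 _) => //.
  rewrite big_nat_recr//= leeDr// sume_ge0// => k _; exact: term_ge0.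
by rewrite x0 lee_fin pmulr_rle0// => h; rewrite eq_le h normc_ge0.
Qed.

HB.instance Definition _ := Lmodule_isNormed.Build R[i] V
  ell1_mnormD ell1_mnormZ ell1_mnorm0_eq0.

Section CesaroOnEll1.
Variable cesaro_in : {homo cesaro_op : x / x \in in_ell1 w}.

Definition cesaro_ell1 (x : V) : V := Ell1 w_gt0 (cesaro_in (ell1_seqP x)).

Fact cesaro_ell1_linear : linear cesaro_ell1.
Proof.
move=> a x y; apply/val_inj/funext => n /=.
rewrite /cesaro_op /= -[RHS]/(a * (_ / _) + _ / _) mulrA -mulrDl mulr_sumr.
by rewrite -big_split.
Qed.

HB.instance Definition _ :=
  GRing.isLinear.Build R[i] V V _ cesaro_ell1 cesaro_ell1_linear.

End CesaroOnEll1.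
End Structure.
End WeightedEll1.

Arguments cesaro_ell1 {R w} w_gt0 cesaro_in x.

Section Operators.
Variables (R : realType) (V : normedModType R[i]).
Implicit Types (T P : {linear V -> V}) (Y Z : set V).

(* Norms in [V] are [R[i]]-valued; [Re] brings them back to [R]. *)
Definition op_norm (S : V -> V) : \bar R :=
  ereal_sup [set (complex.Re `|S x|)%:E | x in [set x | `|x| <= 1]].

Definition cesaro_mean T (n : nat) : V -> V :=
  fun x => n%:R^-1 *: \sum_(1 <= m < n.+1) iter m T x.

Definition power_bounded T : Prop :=
  (ereal_sup [set op_norm (iter n T) | n in [set n | (0 < n)%N]] < +oo)%E.

Definition cesaro_bounded T : Prop :=
  (ereal_sup [set op_norm (cesaro_mean T n) | n in [set n | (0 < n)%N]] < +oo)%E.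

Definition mean_ergodic T : Prop :=
  exists P, continuous P /\ forall x, cesaro_mean T n x @[n --> \oo] --> P x.

Definition complementary Y Z : Prop :=
  Y `&` Z = [set 0] /\ [set y + z | y in Y & z in Z] = setT.

Definition is_projection P Y Z : Prop :=
  complementary Y Z /\ forall y z, Y y -> Z z -> P (y + z) = y.

Definition ker_I_sub T : set V := [set x | x - T x = 0].

Definition range_I_sub T : set V := range (fun x => x - T x).

Definition powers_sot_cvg_to_projection T : Prop :=
  exists P, [/\ continuous P,
    is_projection P (ker_I_sub T) (closure (range_I_sub T)) &
    forall x, iter m T x @[m --> \oo] --> P x].

End Operators.

(* Main.v *)
From HB Require Import structures.
Require Import Defs.
From mathcomp Require Import all_boot all_order all_algebra.
From mathcomp Require Import all_classical all_reals all_analysis.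
From mathcomp Require Import complex.

Import Order.TTheory GRing.Theory Num.Theory.
Import numFieldNormedType.Exports.

Local Open Scope classical_set_scope.
Local Open Scope ring_scope.

Import ComplexField.Normc.

(* The operator is positive and fixes the first coordinate and the constants.
   The iterates of [x] tend coordinatewise to the constant [x 0], hence so do
   the Cesaro means.  If the operators [T_n] (iterates or means) are uniformly
   bounded, Fatou's lemma applied to [T_n e_0] puts the constants in l1(w);
   dominated convergence, with constants as majorants, then gives norm convergence
   on finitely supported sequences, and density extends it to l1(w).  Conversely,
   strong convergence implies uniform boundedness, by a Banach-Steinhaus argument
   that positivity makes elementary. *)

(** * Positivity of operators on sequences, and elementary estimates *)

(** In [R[i]] the inequality [|x j| <= y j] forces [y j] to be real and nonnegative. For linear [T]
    this is positivity, in the form |T x| <= T |x|. *)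
Definition majorizing {R : realType} (T : (nat -> R[i]) -> nat -> R[i]) :=
  forall x y, (forall j, `|x j| <= y j) -> forall j, `|T x j| <= T y j.

Lemma nneseries_ge_term {R : realType} (u : nat -> \bar R) (j : nat) :
  (forall n, 0 <= u n)%E -> (u j <= \sum_(0 <= n <oo) u n)%E.
Proof.
move=> u0; rewrite (@le_trans _ _ (\sum_(0 <= n < j.+1) u n)%E)//.
  by rewrite big_nat_recr//= leeDr// sume_ge0.
exact: nneseries_lim_ge.
Qed.

Lemma ler_sum_nat_term {R : numDomainType} (F : nat -> R) (n i : nat) :
  (forall k, 0 <= F k) -> (i < n)%N -> F i <= \sum_(0 <= k < n) F k.
Proof.
move=> F0 ni; rewrite (bigD1_seq i) ?iota_uniq ?mem_index_iota//= lerDl.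
by rewrite sumr_ge0.
Qed.

Lemma ger0_normc {R : realType} (a : R) : 0 <= a -> normc a%:C%C = a.
Proof. by move=> a0; apply: complexI; rewrite normc_normr ger0_norm// lecR. Qed.

Lemma normc_natV {R : realType} n : normc (n%:R^-1 : R[i]) = n%:R^-1.
Proof. by rewrite -[RHS]ger0_normc ?invr_ge0// fmorphV rmorph_nat. Qed.

Lemma le_normc_sum {R : realType} (I : Type) (s : seq I) (F : I -> R[i]) :
  normc (\sum_(i <- s) F i) <= \sum_(i <- s) normc (F i).
Proof.
elim/big_ind2: _ => //[|a b c d ab cd]; first by rewrite normc0.
by apply: le_trans (le_normcD _ _) _; exact: lerD.
Qed.

(** * The weighted norm: dominated convergence, uniform boundedness, Fatou *)

Section Weighted.
Context {R : realType} {w : nat -> R}.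
Hypothesis w_gt0 : forall n, 0 < w n.
Implicit Types (x y : nat -> R[i]).
Implicit Type T : nat -> {linear (nat -> R[i]) -> (nat -> R[i])}.

Let term_ge0 x n : (0 <= (w n * normc (x n))%:E)%E.
Proof. by rewrite lee_fin mulr_ge0 ?normc_ge0// ltW. Qed.

Lemma le_ell1_norm x y : (forall j, normc (x j) <= normc (y j)) ->
  (ell1_norm w x <= ell1_norm w y)%E.
Proof.
move=> xy; apply: lee_nneseries => [n _ _|n _]; first exact: term_ge0.
by rewrite lee_fin ler_wpM2l// ltW.
Qed.

Lemma le_ell1_norm_normr x y : (forall j, `|x j| <= y j) ->
  (ell1_norm w x <= ell1_norm w y)%E.
Proof.
move=> xy; apply: le_ell1_norm => j; rewrite -lecR !normc_normr.
by apply: le_trans (xy j) _; rewrite ger0_norm// (le_trans _ (xy j)).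
Qed.

Lemma ell1_norm_ge_term x j : ((w j * normc (x j))%:E <= ell1_norm w x)%E.
Proof. by apply: nneseries_ge_term => n; exact: term_ge0. Qed.

(** The norm is an integral against counting measure, so Lebesgue's theorem applies with the
    weighted moduli of [y] as majorant. *)
Lemma ell1_dominated_cvg (z : nat -> nat -> R[i]) y :
    y \in in_ell1 w -> (forall n j, normc (z n j) <= normc (y j)) ->
    (forall j, normc (z n j) @[n --> \oo] --> (0 : R)) ->
  ell1_norm w (z n) @[n --> \oo] --> 0%E.
Proof.
move=> yw zy z0.
pose mu : {measure set nat -> \bar R} := @counting _ R.
pose f x n := (w n * normc (x n))%:E.
have f_norm x : (\int[mu]_j f x j = ell1_norm w x)%E.
  by apply: ge0_integral_count => k; exact: term_ge0.
have f_int x : x \in in_ell1 w -> mu.-integrable setT (f x).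
  move=> xw; apply/integrableP; split=> //.
  rewrite [ltLHS](_ : _ = ell1_norm w x)//; rewrite -f_norm.
  by apply: eq_integral => j _; exact/gee0_abs/term_ge0.
have := @dominated_convergence _ _ _ mu setT measurableT
  (fun n => f (z n)) (cst 0%E) (f y).
case.
- by move=> n.
- by [].
- apply: aeW => j _; rewrite /f; apply/fine_cvgP; split; first exact: nearW.
  by rewrite -[X in _ --> X](mulr0 (w j)); apply: cvgMr; exact: z0.
- exact: f_int.
- apply: aeW => j n _; rewrite gee0_abs ?term_ge0// lee_fin.
  by rewrite ler_wpM2l// ltW.
move=> _ _; rewrite integral0; apply: cvg_trans; apply: near_eq_cvg.
by apply: nearW => n; exact: f_norm.
Qed.

(* No gliding hump: if [|x_k| <= 1] but [|T_(n_k) x_k| > k 2^(k+1)], then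
   positivity makes every term of [y = \sum_k 2^-(k+1) |x_k|] a lower bound, so
   [|T_(n_k) y| > k]. *)
Lemma majorizing_uniform_boundedness T : (forall n, majorizing (T n)) ->
    (forall x, x \in in_ell1 w ->
      exists M : R, forall n, (ell1_norm w (T n x) <= M%:E)%E) ->
  exists K : R, forall n x, (ell1_norm w x <= 1)%E ->
    (ell1_norm w (T n x) <= K%:E)%E.
Proof.
move=> Tmaj Tbnd; apply: contrapT => /forallNP noK.
have /choice[f fP] (k : nat) : exists p : nat * (nat -> R[i]),
    (ell1_norm w p.2 <= 1)%E /\
    ((k%:R * (2 ^ k.+1)%:R)%:E < ell1_norm w (T p.1 p.2))%E.
  have /existsNP[n /existsNP[x /not_implyP[x1 /negP]]] :=
    noK (k%:R * (2 ^ k.+1)%:R).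
  by rewrite -ltNge => ?; exists (n, x).
pose a j k := (w j * normc ((f k).2 j) / (2 ^ k.+1)%:R)%:E.
have a_ge0 j k : (0 <= a j k)%E.
  by rewrite lee_fin divr_ge0// mulr_ge0 ?normc_ge0// ltW.
(* After exchanging the sums, the [k]-th inner sum is at most 2^-(k+1). *)
have a_sum : (\sum_(0 <= j <oo) \sum_(0 <= k <oo) a j k <= 1)%E.
  rewrite nneseries_interchange//.
  apply: le_trans (epsilon_trick0 xpredT ler01).
  apply: lee_nneseries => [k _ _|k _]; first exact: nneseries_ge0.
  rewrite /a; under eq_eseriesr do rewrite mulrC EFinM.
  rewrite nneseriesZl; last by move=> *; exact: term_ge0.
  rewrite div1r -[leRHS]mule1 lee_wpmul2l ?lee_fin ?invr_ge0//.
  exact: (fP k).1.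
pose s j := (\sum_(0 <= k <oo) a j k)%E.
have s_ge0 j : (0 <= s j)%E by apply: nneseries_ge0.
have s_fin j : s j \is a fin_num.
  rewrite ge0_fin_numE//; apply: le_lt_trans (ltry 1); apply: le_trans a_sum.
  exact: (nneseries_ge_term s).
(* Dividing by the weight makes the norm of [y] equal to the double sum bounded above. *)
pose y j : R[i] := (fine (s j) / w j)%:C%C.
have y_norm j : normc (y j) = fine (s j) / w j.
  by rewrite ger0_normc// divr_ge0 ?fine_ge0// ltW.
have yw : y \in in_ell1 w.
  rewrite unfold_in /in_ell1 /ell1_norm; apply: le_lt_trans (ltry 1).
  apply: le_trans a_sum; apply: lee_nneseries => [k _ _|k _]; first exact: term_ge0.
  by rewrite y_norm mulrC divfK ?gt_eqF// fineK.
have y_maj k j : `|((2 ^ k.+1)%:R^-1 *: (f k).2) j| <= y j.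
  rewrite -normc_normr lecR -[leLHS]/(normc (_ * _)) normcM.
  rewrite normc_natV.
  rewrite ler_pdivlMr// -lee_fin fineK//.
  apply: (@le_trans _ _ (a j k)).
    by rewrite lee_fin mulrC mulrA mulrAC.
  exact: nneseries_ge_term.
have [M TM] := Tbnd _ yw.
suff MM k : (k%:R <= M).
  have := MM (Num.bound `|M|); apply/negP; rewrite -ltNge.
  by rewrite (le_lt_trans (ler_norm _))// archi_boundP.
rewrite -lee_fin; apply: le_trans (TM (f k).1).
apply: le_trans (le_ell1_norm_normr _ _ (Tmaj _ _ _ (y_maj k))).
have [_ /ltW fk] := fP k.
rewrite linearZ/= ell1_normZ//.
rewrite normc_natV.
by rewrite lee_pdivlMl// -EFinM mulrC.
Qed.

(** Each partial sum of the norm of [x] is at most [K] plus a finite weighted sum of the errors |z n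
    j - x j|, which tends to 0. *)
Lemma ell1_fatou (z : nat -> nat -> R[i]) x (K : R) :
    (forall j, normc (z n j - x j) @[n --> \oo] --> (0 : R)) ->
    (\forall n \near \oo, (ell1_norm w (z n) <= K%:E)%E) ->
  (ell1_norm w x <= K%:E)%E.
Proof.
move=> zx zK; apply: lime_le.
  by apply: is_cvg_nneseries => n _ _; exact: term_ge0.
apply: nearW => N; rewrite sumEFin lee_fin.
have cvgK : K + \sum_(0 <= j < N) w j * normc (z n j - x j) @[n --> \oo] --> K.
  rewrite -[X in _ --> X]addr0; apply: cvgD; first exact: cvg_cst.
  rewrite -[X in _ --> X](@big1 R 0 +%R nat (index_iota 0 N) xpredT (fun=> 0))//.
  apply: (@cvg_big R^o nat +%R 0 xpredT (@add_continuous R^o)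
    nat \oo (index_iota 0 N)
    (fun j n => w j * normc (z n j - x j)) (fun=> 0)) => j _.
  by rewrite -[X in _ --> X](mulr0 (w j)); apply: cvgMr; exact: zx.
apply: (cvgr_to_ge cvgK); near=> n.
rewrite (@le_trans _ _ (\sum_(0 <= j < N) w j * normc (z n j) +
    \sum_(0 <= j < N) w j * normc (z n j - x j)))//.
  rewrite -big_split/=; apply: ler_sum => j _.
  rewrite -mulrDr ler_wpM2l ?(ltW (w_gt0 _))//.
  rewrite -[in leLHS](subKr (z n j) (x j)).
  by apply: le_trans (le_normcD _ _) _; rewrite normcN.
rewrite lerD2r -lee_fin; apply: (@le_trans _ _ (ell1_norm w (z n))).
  by rewrite -sumEFin; apply: nneseries_lim_ge => *; exact: term_ge0.
by near: n.
Unshelve. all: by end_near. Qed.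

(** * Strong convergence of uniformly bounded positive operators *)

Section StrongConvergence.
Context {T : nat -> {linear (nat -> R[i]) -> (nat -> R[i])}} {K : R}.
Hypothesis T_maj : forall n, majorizing (T n).
(** An inequality rather than an equality, because the mean of index 0 is the zero operator. *)
Hypothesis T_cst1 : forall n j, T n (cst 1) j <= 1.
Hypothesis T_cvg : forall x j,
  normc (T n x j - x 0%N) @[n --> \oo] --> (0 : R).
Hypothesis T_bnd : forall n x, (0 < n)%N -> (ell1_norm w x <= 1)%E ->
  (ell1_norm w (T n x) <= K%:E)%E.

Let delta0 : nat -> R[i] := fun j => (j == 0)%:R.

Lemma cst1_in_ell1 : cst 1 \in in_ell1 w.
Proof.
(* The factor brings e_0 into the unit ball, where [T_bnd] applies; the iterates of [u] then tend
   coordinatewise to the constant [u 0]. *)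
pose u := ((w 0%N)^-1)%:C%C *: delta0.
have uS j : u j.+1 = 0 by exact: mulr0.
have u1 : (ell1_norm w u <= 1)%E.
  rewrite /ell1_norm (nneseries_split 0 1); last by move=> *; exact: term_ge0.
  rewrite big_nat1 eseries0 ?adde0.
    rewrite -[u 0%N]/(_ * 1) mulr1 lee_fin ger0_normc ?invr_ge0 ?(ltW (w_gt0 _))//.
    by rewrite mulfV ?gt_eqF.
  by move=> [|j]// _ _; rewrite uS normc0 mulr0.
have cstK : (ell1_norm w (cst (u 0%N)) <= K%:E)%E.
  apply: (ell1_fatou (fun n => T n u)) => [j|]; first exact: T_cvg.
  by near=> n; apply: T_bnd => //; near: n; exact: nbhs_infty_gt.
have -> : cst 1 = (w 0%N)%:C%C *: cst (u 0%N) :> (nat -> R[i]).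
  apply/funext => j; rewrite -[RHS]/(_ * (_ * 1)) mulr1 -rmorphM/=.
  by rewrite mulfV ?gt_eqF.
rewrite rpredZ//; exact: le_lt_trans cstK (ltry _).
Unshelve. all: by end_near. Qed.

Lemma ell1_strong_cvg x : x \in in_ell1 w -> forall e : R, 0 < e ->
  \forall n \near \oo, (ell1_norm w (T n x - x 0%N *: cst 1)%R <= e%:E)%E.
Proof.
have near_le (z : nat -> nat -> R[i]) : ell1_norm w (z n) @[n --> \oo] --> 0%E ->
    forall e : R, 0 < e -> \forall n \near \oo, (ell1_norm w (z n) <= e%:E)%E.
  move=> /fine_cvgP[z_fin z0] e e0; near=> n.
  rewrite -[ell1_norm _ _]fineK ?lee_fin; last by near: n.
  by near: n; exact: (cvgr_le _ z0).
move=> xw e e0.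
pose trunc N : nat -> R[i] := fun j => if (j < N)%N then x j else 0.
have /near_le trunc_cvg : ell1_norm w (x - trunc n) @[n --> \oo] --> 0%E.
  apply: (@ell1_dominated_cvg _ x) => // [n j|j].
    rewrite -[(x - _) j]/(x j - trunc n j) /trunc.
    by case: ifP; rewrite ?subrr ?normc0 ?normc_ge0// subr0.
  apply: cvg_near_cst; near=> n.
  rewrite -[(x - _) j]/(x j - trunc n j) /trunc ifT ?subrr ?normc0//.
  by near: n; exact: nbhs_infty_gt.
(* [L] is positive and at least [K], so a tail of norm at most [d] has an image of norm at most
   [d * K <= e / 2]. *)
pose L := `|K| + 1.
have L0 : 0 < L by rewrite ltr_wpDl.
pose d := e / 2 / L.
have d0 : 0 < d by rewrite !divr_gt0.
(* With [0 < N] the truncation keeps coordinate 0, so it has the same limit as [x]. *)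
have [N [N0 xN]] : exists N, (0 < N)%N /\ (ell1_norm w (x - trunc N)%R <= d%:E)%E.
  near (\oo : set_system nat) => N; exists N; split.
    by near: N; exact: nbhs_infty_gt.
  by near: N; exact: trunc_cvg.
pose y := trunc N; pose M := \sum_(0 <= k < N) normc (x k).
have yM j : `|y j| <= (M%:C%C *: cst 1 : nat -> R[i]) j.
  rewrite -[leRHS]/(_ * 1) mulr1 -normc_normr lecR /y /trunc.
  case: ifP => [jN|_]; last first.
    by rewrite normc0 sumr_ge0// => k _; exact: normc_ge0.
  by apply: (ler_sum_nat_term (fun k => normc (x k))) => // k; exact: normc_ge0.
have M0 : 0 <= M by apply: sumr_ge0 => k _; exact: normc_ge0.
(* Positivity gives |T y| <= M T 1 <= M, and |y 0| <= M as well: the constant [M + M] is the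
   integrable majorant. *)
have TyM n j : normc ((T n y - y 0%N *: cst 1) j) <=
    normc (((M + M)%:C%C *: cst 1 : nat -> R[i]) j).
  rewrite -lecR !normc_normr -[leRHS]/`|_ * 1| mulr1 -[leLHS]/`|_ - _ * 1| mulr1.
  rewrite [leRHS]ger0_norm; last by rewrite lecR addr_ge0.
  rewrite rmorphD/=.
  apply: le_trans (ler_normB _ _) _; rewrite lerD//; last first.
    by have := yM 0%N; rewrite -[leRHS]/(_ * 1) mulr1.
  apply: le_trans (T_maj _ _ _ yM _) _; rewrite linearZ/=.
  by rewrite -[leLHS]/(_ * _) ler_piMr// lecR.
have Ty_cvg : ell1_norm w (T n y - y 0%N *: cst 1) @[n --> \oo] --> 0%E.
  apply: ell1_dominated_cvg _ TyM _ => [|j]; first exact/rpredZ/cst1_in_ell1.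
  under eq_fun do rewrite -[(_ - _) j]/(_ - _ * 1) mulr1.
  exact: T_cvg.
have e20 : 0 < e / 2 by rewrite divr_gt0.
near=> n.
have -> : T n x - x 0%N *: cst 1 = T n (x - y) + (T n y - y 0%N *: cst 1).
  by rewrite /y /trunc N0 linearB/= addrA subrK.
apply: le_trans (ell1_normD w_gt0 _ _) _.
rewrite [e]splitr EFinD leeD//; last by near: n; exact: near_le.
(* The tail is rescaled by [d] to enter the unit ball. *)
rewrite -[x - y](scalerKV (lt0r_neq0 (_ : 0 < d%:C%C))) ?lecR ?ltcR//.
rewrite linearZ/= ell1_normZ//.
rewrite ger0_normc ?(ltW d0)// /d -lee_pdivlMl//.
apply: (@le_trans _ _ K%:E).
  apply: T_bnd; first by near: n; exact: nbhs_infty_gt.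
  rewrite ell1_normZ// -fmorphV ger0_normc ?invr_ge0 ?(ltW d0)//.
  by rewrite lee_pdivrMl ?mule1.
rewrite -EFinM lee_fin invf_div divfK ?gt_eqF// (le_trans (ler_norm _))//.
by rewrite lerDl.
Unshelve. all: by end_near. Qed.

End StrongConvergence.
End Weighted.

(** * Iterates and means as linear maps *)

Section LinearIterates.
Context {K : numFieldType} {V : lmodType K}.

(** The formula of [cesaro_mean] over a bare [lmodType], so that it applies to the space of all
    sequences. At [n = 0] it vanishes, since [0^-1 = 0]. *)
Definition iter_mean (T : V -> V) (n : nat) (x : V) : V :=
  n%:R^-1 *: \sum_(1 <= m < n.+1) iter m T x.

Variable T : {linear V -> V}.

Fact iter_linear n : linear (iter n T).
Proof. by move=> a x y; elim: n => //= n ->; rewrite linearP. Qed.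

HB.instance Definition _ n :=
  GRing.isLinear.Build K V V _ (iter n T) (iter_linear n).

Fact iter_mean_linear n : linear (iter_mean T n).
Proof.
move=> a x y; rewrite /iter_mean scalerA mulrC -scalerA -scalerDr; congr (_ *: _).
by rewrite scaler_sumr -big_split; apply: eq_bigr => m _; rewrite linearP.
Qed.

HB.instance Definition _ n :=
  GRing.isLinear.Build K V V _ (iter_mean T n) (iter_mean_linear n).

End LinearIterates.

(** * The Cesaro operator on all sequences: positivity and coordinatewise limits *)

Section CesaroOp.
Context {R : realType}.
Implicit Types x : nat -> R[i].

Fact cesaro_op_linear : linear (@cesaro_op R).
Proof.
move=> a x y; apply/funext => n; rewrite /cesaro_op -[RHS]/(a * (_ / _) + _ / _).
by rewrite mulrA -mulrDl mulr_sumr -big_split.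
Qed.

HB.instance Definition _ := GRing.isLinear.Build R[i] (nat -> R[i]) (nat -> R[i])
  _ (@cesaro_op R) cesaro_op_linear.

Lemma cesaro_op_majorizing : majorizing (@cesaro_op R).
Proof.
move=> x y xy j; rewrite /cesaro_op normrM (@ger0_norm _ _^-1)//.
rewrite ler_wpM2r// (le_trans (ler_norm_sum _ _ _))//.
by apply: ler_sum => k _; exact: xy.
Qed.

Lemma iter_cesaro_majorizing m : majorizing (iter m (@cesaro_op R)).
Proof. by elim: m => // m IHm x y xy; apply/cesaro_op_majorizing/IHm. Qed.

Lemma iter_mean_cesaro_majorizing n : majorizing (iter_mean (@cesaro_op R) n).
Proof.
move=> x y xy j; rewrite /iter_mean -[leLHS]/`|_ * _| -[leRHS]/(_ * _) normrM.
rewrite ger0_norm// ler_wpM2l//.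
rewrite !fct_sumE (le_trans (ler_norm_sum _ _ _))//.
by apply: ler_sum => m _; exact: iter_cesaro_majorizing.
Qed.

Lemma iter_cesaro_cst m (c : R[i]) : iter m (@cesaro_op R) (cst c) = cst c.
Proof.
elim: m => //= m ->; apply/funext => n; rewrite /cesaro_op sumr_const_nat subn0.
by rewrite -[_ *+ n.+1]mulr_natr mulfK.
Qed.

Lemma iter_mean_cesaro_cst n (c : R[i]) : (0 < n)%N ->
  iter_mean (@cesaro_op R) n (cst c) = cst c.
Proof.
move=> n0; apply/funext => j; rewrite /iter_mean -[LHS]/(_ * _) fct_sumE.
under eq_bigr do rewrite iter_cesaro_cst.
by rewrite sumr_const_nat subn1 -[cst c j *+ _]mulr_natl mulKf// pnatr_eq0 -lt0n.
Qed.

Lemma iter_cesaro0 m x : iter m (@cesaro_op R) x 0%N = x 0%N.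
Proof. by elim: m => //= m <-; rewrite /cesaro_op big_nat1 divr1. Qed.

(* The deviation from [x 0] vanishes at index 0, so averaging the indices
   [0..i] contracts its maximum by [i / (i + 1)]. *)
Lemma iter_cesaro_dist x j m i : (i <= j)%N ->
  normc (iter m (@cesaro_op R) x i - x 0%N) <=
  (j%:R / j.+1%:R) ^+ m * \sum_(0 <= k < j.+1) normc (x k - x 0%N).
Proof.
(* The sum of the deviations serves as an upper bound for their maximum. *)
set M := \sum_(_ <= _ < _) _.
have M0 : 0 <= M by apply: sumr_ge0 => k _; exact: normc_ge0.
elim: m i => [|m IHm] i ij.
  rewrite mul1r; apply: (ler_sum_nat_term (fun k => normc (x k - x 0%N))) => // k.
  exact: normc_ge0.
rewrite iterS; set y := iter m _ x in IHm *.
(* The deviation at index 0 vanishes, so only [i] terms are averaged over [i + 1]. *)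
have -> : cesaro_op y i - x 0%N =
    (\sum_(1 <= k < i.+1) (y k - x 0%N)) * i.+1%:R^-1.
  rewrite sumrB sumr_const_nat subn1/= /cesaro_op (@big_ltn _ _ _ 0%N)//.
  have -> : y 0%N = x 0%N by exact: iter_cesaro0.
  apply: (mulIf (_ : i.+1%:R != 0 :> R[i])) => //.
  rewrite mulrBl !divfK// -natr1 mulrDr mulr1 mulr_natr.
  by rewrite [x 0%N *+ i + _]addrC opprD addrACA subrr add0r.
rewrite normcM normc_natV exprS.
apply: (@le_trans _ _ (i%:R / i.+1%:R * ((j%:R / j.+1%:R) ^+ m * M))).
  rewrite mulrAC ler_wpM2r// (le_trans (le_normc_sum _ _ _))//.
  rewrite (@le_trans _ _ (\sum_(1 <= k < i.+1) ((j%:R / j.+1%:R) ^+ m * M)))//.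
    rewrite big_seq [leRHS]big_seq; apply: ler_sum => k.
    by rewrite mem_index_iota => /andP[_ ki]; apply/IHm/(leq_trans _ ij).
  by rewrite sumr_const_nat subn1 -[_ *+ i.+1.-1]mulr_natl.
(* The ratio [i / (i + 1)] increases with [i], hence is at most [j / (j + 1)]. *)
rewrite mulrA ler_wpM2r// ler_wpM2r ?exprn_ge0//.
by rewrite ler_pdivrMr// mulrAC ler_pdivlMr// -!natrM ler_nat !mulnS mulnC leq_add2r.
Qed.

Lemma iter_cesaro_cvg x j :
  normc (iter m (@cesaro_op R) x j - x 0%N) @[m --> \oo] --> (0 : R).
Proof.
apply: (squeeze_cvgr _ (cvg_cst 0) (cvg_geometric
  (\sum_(0 <= k < j.+1) normc (x k - x 0%N)) (_ : `|j%:R / j.+1%:R| < 1))).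
  apply: nearW => m; rewrite normc_ge0/= /geometric/= mulrC.
  exact: iter_cesaro_dist.
by rewrite ger0_norm// ltr_pdivrMr// mul1r ltr_nat.
Qed.

(** The deviation of the mean is at most the mean of the deviations, which tends to 0 by Cesaro's
    lemma. The shift in [u] reflects that the means start at the first power. *)
Lemma iter_mean_cesaro_cvg x j :
  normc (iter_mean (@cesaro_op R) n x j - x 0%N) @[n --> \oo] --> (0 : R).
Proof.
pose u m := normc (iter m.+1 (@cesaro_op R) x j - x 0%N).
have /cesaro u0 : u @ \oo --> (0 : R) 
  by have := iter_cesaro_cvg x j; rewrite -cvg_shiftS.
rewrite -cvg_shiftS; apply: squeeze_cvgr (cvg_cst 0) u0.
apply: nearW => n; rewrite normc_ge0/=.
have -> : iter_mean (@cesaro_op R) n.+1 x j - x 0%N =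
    n.+1%:R^-1 * \sum_(1 <= m < n.+2) (iter m (@cesaro_op R) x j - x 0%N).
  rewrite sumrB sumr_const_nat subn1/= mulrBr -[x 0%N *+ _]mulr_natl mulKf//.
  by congr (_ - _); rewrite /iter_mean -[LHS]/(_ * _) fct_sumE.
rewrite normcM normc_natV /arithmetic_mean/= /series/= ler_wpM2l//.
by rewrite big_add1/=; exact: le_normc_sum.
Qed.

End CesaroOp.

(** * Normed spaces: uniform bounds, and limits of iterates as projections *)

Section NormedOperators.
Context {R : realType} {V : normedModType R[i]}.

(** Turns both power boundedness and Cesaro boundedness into a real bound on the unit ball. *)
Lemma sup_op_norm_ltyP (S : nat -> V -> V) :
  (ereal_sup [set op_norm (S n) | n in [set n | (0 < n)%N]] < +oo)%E <->
  exists K : R, forall n x, (0 < n)%N -> `|x| <= 1 -> `|S n x| <= K%:C%C.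
Proof.
have ReE (z : R[i]) : 0 <= z -> (complex.Re z)%:C%C = z.
  by move=> z0; rewrite RRe_real// ger0_real.
split=> [supS|[K SK]]; last first.
  apply: le_lt_trans (ltry K); apply: ge_ereal_sup => _ [n n0 <-].
  apply: ge_ereal_sup => _ [x x1 <-].
  by rewrite lee_fin -lecR ReE//; exact: SK.
exists (fine (ereal_sup [set op_norm (S n) | n in [set n | (0 < n)%N]])).
move=> n x n0 x1.
have : ((complex.Re `|S n x|)%:E <=
    ereal_sup [set op_norm (S n) | n in [set n | (0 < n)%N]])%E.
  apply: (@le_trans _ _ (op_norm (S n))); apply: ereal_sup_ubound => /=.
    by exists x.
  by exists n.
by case: ereal_sup supS => [s|//|]//= _; rewrite ?lee_fin -?lecR ?ReE.
Qed.

Variables (T P : {linear V -> V}).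
Hypotheses (T_cont : continuous T) (P_cont : continuous P).
Hypothesis iterT_cvg : forall x, iter m T x @[m --> \oo] --> P x.

Let lim_unique (u : nat -> V) (l l' : V) : u @ \oo --> l -> u @ \oo --> l' -> l = l'.
Proof. exact: (cvg_unique (@norm_hausdorff _ V)). Qed.

Let iterTS_cvg x : iter m.+1 T x @[m --> \oo] --> P x.
Proof. by have := iterT_cvg x; rewrite -cvg_shiftS. Qed.

(** Limits of [T^(m+1)] give [T P = P T = P]. So [P] has image in the kernel of [I - T], which it
    fixes, and vanishes on the closed range. As x - T^m x lies in the range, x - P x lies in its
    closure. *)
Lemma limit_of_iterates_is_projection :
  is_projection P (ker_I_sub T) (closure (range_I_sub T)).
Proof.
have TP x : T (P x) = P x.
  apply: (lim_unique (fun m => iter m.+1 T x)) => //.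
  exact: (cvg_comp _ _ (iterT_cvg x) (T_cont (P x))).
have PT x : P (T x) = P x.
  apply: (lim_unique (fun m => iter m.+1 T x)) => //.
  by have := iterT_cvg (T x); under eq_fun do rewrite -iterSr.
have P_ker y : ker_I_sub T y -> P y = y.
  move=> /subr0_eq yT; apply: (lim_unique (fun m => iter m T y)) => //.
  have -> : (fun m => iter m T y) = cst y; last exact: cvg_cst.
  by apply/funext => m; elim: m => //= m ->.
have P_range z : closure (range_I_sub T) z -> P z = 0.
  have P0_closed : closed (P @^-1` [set 0]).
    apply: closed_comp => //; apply: accessible_closed_set1.
    exact/hausdorff_accessible/norm_hausdorff.
  move=> /(closure_subset (_ : range_I_sub T `<=` P @^-1` [set 0])).
  rewrite -(closure_id _).1//; apply => _ [u _ <-] /=.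
  by rewrite linearB/= PT subrr.
(* Telescoping: each further power adds [iter m T x] to the preimage. *)
have range_iter x m : range_I_sub T (x - iter m T x).
  elim: m => [|m [u _ uE]]; first by exists 0 => //; rewrite linear0 !subrr.
  exists (u + iter m T x) => //=; rewrite linearD opprD addrACA uE.
  by rewrite addrA subrK.
split; last by move=> y z /P_ker yP /P_range zP; rewrite linearD/= yP zP addr0.
split.
  apply/seteqP; split => [x [/P_ker xP /P_range x0]|x ->].
    by rewrite /= -xP.
  split.
    by rewrite /ker_I_sub/= linear0 subrr.
  by apply: subset_closure; exists 0 => //; rewrite linear0 subrr.
apply/seteqP; split => // x _; exists (P x); first by rewrite /ker_I_sub/= TP subrr.
exists (x - P x); last by rewrite addrC subrK.
apply: (@closed_cvg _ _ \oo _ (fun m => x - iter m T x)).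
- exact: closed_closure.
- by apply: nearW => m; apply/subset_closure/range_iter.
- by apply: cvgB => //; exact: cvg_cst.
Qed.

End NormedOperators.

(** * The rank-one limit operator *)

Section ScaledEvaluation.
Context {R : realType} {w : nat -> R} {w_gt0 : forall n, 0 < w n}.
Local Notation V := (ell1 w_gt0).

(** With [v] the constant 1, this is the limit of the iterates and of the means. *)
Definition scaled_eval0 (v x : V) : V := x 0%N *: v.

Fact scaled_eval0_linear v : linear (scaled_eval0 v).
Proof. by move=> a x y; rewrite /scaled_eval0 scalerDl scalerA. Qed.

HB.instance Definition _ v :=
  GRing.isLinear.Build R[i] V V _ (scaled_eval0 v) (scaled_eval0_linear v).

(** [w 0 * |x 0|] is one term of the norm of [x], so evaluation at 0 has norm at most [1 / w 0]. *)
Lemma scaled_eval0_continuous v : continuous (scaled_eval0 v).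
Proof.
have w0 : 0 < (w 0%N)%:C%C by rewrite ltcR.
apply/linear_bounded_continuous/linear_boundedP; near=> r => x.
rewrite /scaled_eval0 normrZ (@le_trans _ _ ((w 0%N)%:C%C^-1 * `|x| * `|v|))//.
  rewrite ler_wpM2r// ler_pdivlMl// -normc_normr -rmorphM/= lecR -lee_fin.
  by rewrite fineK ?ell1_norm_fin_num// (ell1_norm_ge_term w_gt0 x).
rewrite mulrAC ler_wpM2r//; near: r; apply: nbhs_pinfty_ge.
by rewrite realM ?realV// ger0_real// ltW.
Unshelve. all: by end_near. Qed.

End ScaledEvaluation.

(** * Transfer between all sequences and the normed space *)

Section Ell1Operators.
Context {R : realType} {w : nat -> R} {w_gt0 : forall n, 0 < w n}.
Local Notation V := (ell1 w_gt0).

Lemma ell1_normr_le (x : V) (K : R) : (`|x| <= K%:C%C) = (ell1_norm w x <= K%:E)%E.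
Proof.
rewrite -[`|x|]/((fine (ell1_norm w x))%:C%C) lecR -lee_fin fineK//.
exact: ell1_norm_fin_num.
Qed.

(** [T] acts on all sequences, where coordinatewise limits are taken; [S] is its restriction to the
    normed space. *)
Context {T : nat -> {linear (nat -> R[i]) -> (nat -> R[i])}} {S : nat -> V -> V}.
Hypothesis ST : forall n x, S n x = T n x :> (nat -> R[i]).
Hypothesis T_maj : forall n, majorizing (T n).

(** Convergent sequences are norm bounded, so the uniform boundedness principle for positive
    operators applies. *)
Lemma ell1_pointwise_cvg_bounded : (forall x, cvgn (fun n => S n x)) ->
  exists K : R, forall n x, (0 < n)%N -> `|x| <= 1 -> `|S n x| <= K%:C%C.
Proof.
move=> S_cvg.
have [|K TK] := majorizing_uniform_boundedness w_gt0 T T_maj.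
  move=> x xw.
  have [M M0 SM] := pinfty_ex_gt0 (cvg_seq_bounded (S_cvg (Ell1 w_gt0 xw))).
  exists (complex.Re M) => n; rewrite -[x]/(ell1_seq (Ell1 w_gt0 xw)) -ST.
  by rewrite -ell1_normr_le RRe_real ?gtr0_real//; exact: SM.
exists K => n x _ x1; rewrite ell1_normr_le ST; apply: TK.
by rewrite -ell1_normr_le.
Qed.

Hypothesis T_cst1 : forall n j, T n (cst 1) j <= 1.
Hypothesis T_cvg : forall x j,
  normc (T n x j - x 0%N) @[n --> \oo] --> (0 : R).

(** The bound puts the constants in the space, which makes x -> x 0 * 1 an operator on it and the
    strong limit. *)
Lemma ell1_bounded_strong_cvg :
    (exists K : R, forall n x, (0 < n)%N -> `|x| <= 1 -> `|S n x| <= K%:C%C) ->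
  exists P : {linear V -> V}, continuous P /\ forall x, S n x @[n --> \oo] --> P x.
Proof.
move=> [K SK].
have T_bnd n (x : nat -> R[i]) : (0 < n)%N -> (ell1_norm w x <= 1)%E ->
    (ell1_norm w (T n x) <= K%:E)%E.
  move=> n0 x1; have xw : x \in in_ell1 w by exact: le_lt_trans x1 (ltry _).
  rewrite -[x]/(ell1_seq (Ell1 w_gt0 xw)) -ST -ell1_normr_le; apply: SK => //.
  by rewrite -[1]/(1%:C%C) ell1_normr_le.
pose one : V := Ell1 w_gt0 (cst1_in_ell1 w_gt0 T_cvg T_bnd).
exists (scaled_eval0 one); split; first exact: scaled_eval0_continuous.
move=> x; apply/cvgrPdist_le => e e0.
have eE : (complex.Re e)%:C%C = e by rewrite RRe_real// gtr0_real.
near=> n; rewrite distrC.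
rewrite -eE ell1_normr_le.
rewrite -[ell1_seq _]/(ell1_seq (S n x) - x 0%N *: cst 1) ST.
near: n; apply: (ell1_strong_cvg w_gt0 T_maj T_cst1 T_cvg T_bnd _ (ell1_seqP x)).
by rewrite -ltcR eE.
Unshelve. all: by end_near. Qed.

End Ell1Operators.

Theorem theorem4p6 (R : realType) (w : nat -> R)
    (w_gt0 : forall n : nat, 0 < w n) (w_bounded : bounded_fun w)
    (cesaro_in : {homo @cesaro_op R : x / x \in in_ell1 w})
    (cesaro_cont : continuous (cesaro_ell1 w_gt0 cesaro_in)) :
  let C1w : {linear ell1 w_gt0 -> ell1 w_gt0} := cesaro_ell1 w_gt0 cesaro_in in
  ((power_bounded C1w <-> powers_sot_cvg_to_projection C1w) /\
   (power_bounded C1w -> mean_ergodic C1w)) /\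
  (mean_ergodic C1w <-> cesaro_bounded C1w).
Proof.
move=> C1w.
have iterE n (x : ell1 w_gt0) :
    iter n C1w x = iter n (@cesaro_op R) x :> (nat -> R[i]).
  by elim: n => //= n <-.
have meanE n (x : ell1 w_gt0) :
    cesaro_mean C1w n x = iter_mean (@cesaro_op R) n x :> (nat -> R[i]).
  congr (_ *: _).
  rewrite raddf_sum.
  by apply: eq_bigr => m _; exact: iterE.
pose Tp n : {linear (nat -> R[i]) -> (nat -> R[i])} := iter n (@cesaro_op R).
pose Tm n : {linear (nat -> R[i]) -> (nat -> R[i])} := iter_mean (@cesaro_op R) n.
have power_boundedP := sup_op_norm_ltyP (fun n => iter n C1w).
have cesaro_boundedP := sup_op_norm_ltyP (cesaro_mean C1w).
have ergodic : mean_ergodic C1w <-> cesaro_bounded C1w.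
  split=> [[P [_ CP]]|/cesaro_boundedP].
    apply/cesaro_boundedP/(@ell1_pointwise_cvg_bounded _ _ _ Tm) => //.
      exact: iter_mean_cesaro_majorizing.
    by move=> x; apply: cvgP (CP x).
  apply: (@ell1_bounded_strong_cvg _ _ _ Tm) => //.
  - exact: iter_mean_cesaro_majorizing.
  - move=> [|n] j; last by rewrite /= iter_mean_cesaro_cst.
    (* The mean of index 0 is zero. *)
    by rewrite /= /iter_mean invr0 scale0r.
  - exact: iter_mean_cesaro_cvg.
split; last exact: ergodic.
split.
  split=> [/power_boundedP|[P [_ _ CP]]].
    move=> /(@ell1_bounded_strong_cvg _ _ _ Tp)[]//.
    - exact: iter_cesaro_majorizing.
    - by move=> n j; rewrite /= iter_cesaro_cst.
    - exact: iter_cesaro_cvg.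
    move=> P [P_cont CP]; exists P; split=> //.
    exact: limit_of_iterates_is_projection.
  apply/power_boundedP/(@ell1_pointwise_cvg_bounded _ _ _ Tp) => //.
    exact: iter_cesaro_majorizing.
  by move=> x; apply: cvgP (CP x).
(* A mean of powers bounded by [K] is bounded by [K], so power boundedness implies Cesaro
   boundedness. *)
move=> /power_boundedP[K CK]; apply/ergodic/cesaro_boundedP; exists K => n x n0 x1.
rewrite /cesaro_mean normrZ ger0_norm ?invr_ge0//.
rewrite ler_pdivrMl ?ltr0n// (le_trans (ler_norm_sum _ _ _))//.
rewrite (@le_trans _ _ (\sum_(1 <= m < n.+1) K%:C%C))//.
  by rewrite big_nat [leRHS]big_nat; apply: ler_sum => m /andP[m0 _]; exact: CK.
by rewrite sumr_const_nat subn1 -[K%:C%C *+ _]mulr_natl.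
Qed.
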